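(* $6-4\sqrt{2}\leq i(\vec K_{1,2})=i(\vec K_{2,1})\leq 0.4644$.
   Context: An orgraph (oriented graph) is a directed graph with no loops, no multiple edges, and no pair of vertices joined by edges in both directions. For a finite orgraph $\Gamma$ and an integer $n$, let $max(\Gamma;n)$ be the maximum, over all orgraphs $G$ on $n$ vertices, of the number of vertex subsets $T\subseteq V(G)$ with $|T|=|V(\Gamma)|$ such that the subgraph of $G$ induced by $T$ is isomorphic to $\Gamma$ (each such set is counted once, regardless of automorphisms of $\Gamma$). The inducibility of $\Gamma$ is $i(\Gamma):=\limsup_{n\to\infty} max(\Gamma;n)/\binom{n}{|V(\Gamma)|}$. Here $\vec K_{1,2}$ is the orgraph on vertices $a,b,c$ with edges $a\to b$ and $a\to c$ only (one vertex sending edges to two non-adjacent vertices), and $\vec K_{2,1}$ is the orgraph on vertices $a,b,c$ with edges $b\to a$ and $c\to a$ only (two non-adjacent vertices both sending an edge to a third vertex). *)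

(* Defs.v *)
From HB Require Import structures.
From mathcomp Require Import all_boot all_order all_algebra.
From mathcomp Require Import all_classical all_reals.
From mathcomp Require Import topology normedtype sequences.
Set Implicit Arguments. Unset Strict Implicit. Unset Printing Implicit Defensive.
Import Order.TTheory GRing.Theory Num.Theory.
Local Open Scope ring_scope.

Definition digraph (n : nat) := {ffun 'I_n * 'I_n -> bool}.

(* Orgraph: no loops, no pair of opposite arcs (multiple arcs are impossible
   in this representation). *)
Definition is_orgraph n (G : digraph n) : bool :=
  [forall x, ~~ G (x, x)] && [forall x, forall y, ~~ (G (x, y) && G (y, x))].

Definition induced_count k n (H : digraph k) (G : digraph n) : nat :=
  #|[set T : {set 'I_n} | (#|T| == k) &&
      [exists f : {ffun 'I_k -> 'I_n},
         [&& injectiveb f, f @: setT == T &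
             [forall i, forall j, G (f i, f j) == H (i, j)]]]]|.

Definition max_induced k (H : digraph k) (n : nat) : nat :=
  (\max_(G : digraph n | is_orgraph G) induced_count H G)%N.

Definition inducibility (R : realType) k (H : digraph k) : R :=
  limn_sup (fun n : nat => (max_induced H n)%:R / ('C(n, k))%:R : R).

Definition K12 : digraph 3 :=
  [ffun p : 'I_3 * 'I_3 => (val p.1 == 0%N) && (val p.2 != 0%N)].
Definition K21 : digraph 3 :=
  [ffun p : 'I_3 * 'I_3 => (val p.1 != 0%N) && (val p.2 == 0%N)].

(* Main.v *)
(** Weight the vertices of an orgraph by [x >= 0] and let the weight of the stars
    be the sum of [x w * x u * x v] over [w -> u], [w -> v] with [u], [v]
    nonadjacent, the case [u = v] included.  Along a shift of mass between two
    nonadjacent vertices this is a convex function, so it increases when one of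
    the two is emptied; hence the maximum is attained on a tournament, where the
    weight is the sum of [x w * x u ^ 2] over the arcs [w -> u].  Removing the
    vertex of largest weight [m] from a tournament with remaining mass [a] loses
    at most [a * m ^ 2], and by induction three times the weight is at most
    [c * s ^ 3], [s] the total mass, as soon as [c ^ 2 + 6 * c >= 3], i.e.
    [c >= 2 * sqrt 3 - 3].  Unit weights give the upper bound.  For the lower
    bound, orienting all arcs of a balanced complete bipartite graph from one
    side to the other has density at least [3 / 8 > 6 - 4 * sqrt 2].  Reversing
    all arcs exchanges the two stars. *)
Require Import Defs.
From HB Require Import structures.
From mathcomp Require Import all_boot all_order all_algebra.
From mathcomp Require Import all_classical all_reals.
From mathcomp Require Import topology normedtype sequences.
From mathcomp Require Import ring lra zify.
Set Implicit Arguments. Unset Strict Implicit. Unset Printing Implicit Defensive.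
Import Order.TTheory GRing.Theory Num.Theory.
Import numFieldNormedType.Exports.
Local Open Scope ring_scope.

(** * Removing a heaviest vertex: the cubic inequality *)

Lemma star_recursion_ineq (R : realFieldType) (c a m : R) :
  0 < c -> 3 <= c ^+ 2 + 6 * c -> 0 <= a -> 0 <= m ->
  c * a ^+ 3 + 3 * (a * m ^+ 2) <= c * (a + m) ^+ 3.
Proof.
move=> c0 hc a0 m0.
(* The two sides differ by [m] times this quadratic form, whose discriminant in [m] is
   [- 3 * a ^ 2 * (c ^ 2 + 6 * c - 3) <= 0]. *)
have q0 : 0 <= 3 * c * a ^+ 2 - 3 * (1 - c) * a * m + c * m ^+ 2.
  rewrite -(pmulr_rge0 _ (_ : 0 < 4 * c)); last by rewrite mulr_gt0.
  have -> : 4 * c * (3 * c * a ^+ 2 - 3 * (1 - c) * a * m + c * m ^+ 2) =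
    (2 * c * m - 3 * (1 - c) * a) ^+ 2 + 3 * a ^+ 2 * (c ^+ 2 + 6 * c - 3).
    by ring.
  by rewrite addr_ge0 ?sqr_ge0// mulr_ge0 ?subr_ge0// mulr_ge0 ?sqr_ge0.
rewrite -subr_ge0.
have -> : c * (a + m) ^+ 3 - (c * a ^+ 3 + 3 * (a * m ^+ 2)) =
  m * (3 * c * a ^+ 2 - 3 * (1 - c) * a * m + c * m ^+ 2) by ring.
by rewrite mulr_ge0.
Qed.

(** * Weighted stars in an orgraph *)

Section WeightedStars.
Variables (R : realFieldType) (V : finType) (e : rel V).
Hypothesis e_asym : forall u v, ~~ (e u v && e v u).
Implicit Types (x y z : V -> R).

Definition nonadj (u v : V) := ~~ e u v && ~~ e v u.

Definition outpair_weight x (w : V) : R :=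
  \sum_u \sum_v [&& e w u, e w v & nonadj u v]%:R * (x u * x v).

(* Degenerate stars [u = v] are counted too; they make the weight convex when
   mass is shifted between two nonadjacent vertices. *)
Definition star_weight x : R := \sum_w x w * outpair_weight x w.

Lemma e_irr u : e u u = false.
Proof. by have := e_asym u u; rewrite andbb => /negbTE. Qed.

Lemma nonadjC u v : nonadj u v = nonadj v u.
Proof. by rewrite /nonadj andbC. Qed.

Lemma nonadj_refl u : nonadj u u.
Proof. by rewrite /nonadj e_irr. Qed.

Lemma tournament_weight_le (c : R) x (S : {set V}) :
  0 < c -> 3 <= c ^+ 2 + 6 * c -> (forall v, 0 <= x v) ->
  3 * (\sum_(w in S) \sum_(u in S) (e w u)%:R * (x w * x u ^+ 2)) <=
  c * (\sum_(v in S) x v) ^+ 3.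
Proof.
move=> c0 hc x0; have [k] := ubnP #|S|; elim: k S => // k IH S.
have [->|/finset.set0Pn[v0 v0S]] := eqVneq S finset.set0; first by rewrite !big_set0 expr0n !mulr0.
rewrite ltnS => Sk.
case: (arg_maxP x v0S) => m mS mmax.
have {}IH := IH (S :\ m) (leq_trans (proper_card (properD1 mS)) Sk).
set T := S :\ m in IH *; rewrite !(big_setD1 m mS) /= -/T e_irr mul0r add0r.
under [X in _ + X]eq_bigr => w _ do rewrite (big_setD1 m mS) /= -/T.
rewrite big_split /=.
(* At most one arc joins [m] and [u]; in either direction it contributes at most [x u * x m ^ 2],
   because [x u <= x m]. *)
have hm : \sum_(u in T) (e m u)%:R * (x m * x u ^+ 2) +
    \sum_(w in T) (e w m)%:R * (x w * x m ^+ 2) <= (\sum_(v in T) x v) * x m ^+ 2.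
  rewrite -big_split mulr_suml; apply: ler_sum => u; rewrite !inE => /andP[_ uS] /=.
  have xx : x m * x u ^+ 2 <= x u * x m ^+ 2.
    have -> : x m * x u ^+ 2 = (x u * x m) * x u by ring.
    have -> : x u * x m ^+ 2 = (x u * x m) * x m by ring.
    by rewrite ler_wpM2l ?mulr_ge0//; exact: mmax.
  have := e_asym m u; case: (e m u); case: (e u m) => //= _;
    rewrite ?mul1r ?mul0r ?addr0 ?add0r// mulr_ge0// exprn_ge0//.
rewrite addrA mulrDr [x m + \sum_(v in T) x v]addrC.
apply: le_trans (star_recursion_ineq c0 hc (_ : 0 <= \sum_(v in T) x v) (x0 m)); last first.
  by apply: sumr_ge0 => v _; exact: x0.
by rewrite [leLHS]addrC; apply: lerD; rewrite // ler_wpM2l// ler0n.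
Qed.

(** The support of [x] induces a tournament, so only the degenerate stars survive. *)
Lemma star_weight_tournament x :
  (forall u v, u != v -> nonadj u v -> x u * x v = 0) ->
  star_weight x = \sum_w \sum_u (e w u)%:R * (x w * x u ^+ 2).
Proof.
move=> hx; apply: eq_bigr => w _; rewrite mulr_sumr; apply: eq_bigr => u _.
rewrite (bigD1 u) //= nonadj_refl andbT andbb big1 ?addr0 => [|v vu].
  by rewrite mulrCA expr2.
case: (boolP (nonadj u v)) => [nuv|]; last by rewrite !andbF mul0r.
by rewrite hx ?mulr0// eq_sym.
Qed.

Definition shift x (u v : V) : V -> R :=
  fun w => if w == u then x u + x v else if w == v then 0 else x w.

Lemma shift_ge0 x u v : (forall w, 0 <= x w) -> forall w, 0 <= shift x u v w.
Proof. by move=> x0 w; rewrite /shift; do 2?[case: ifP => // _]; rewrite addr_ge0. Qed.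

Lemma sum_shift x u v : u != v -> \sum_w shift x u v w = \sum_w x w.
Proof.
move=> uv; have vu : v != u by rewrite eq_sym.
rewrite (bigD1 u)// [RHS](bigD1 u)//= (bigD1 v)//= [X in _ = _ + X](bigD1 v)//=.
rewrite /shift eqxx (negbTE vu) eqxx add0r -addrA; congr (_ + (_ + _)).
by apply: eq_bigr => w /andP[/negbTE-> /negbTE->].
Qed.

(** Termination measure for repeated shifting: [v] leaves the support and [u] was already in it. *)
Lemma support_shift x u v : u != v -> x u != 0 -> x v != 0 ->
  [set w | shift x u v w != 0] \proper [set w | x w != 0].
Proof.
move=> uv xu xv; apply/fintype.properP; split.
  apply/fintype.subsetP => w; rewrite !inE /shift; case: (eqVneq w u) => [->//|_].
  by case: (eqVneq w v) => [_|//]; rewrite eqxx.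
by exists v; rewrite !inE// /shift [v == u]eq_sym (negbTE uv) !eqxx.
Qed.

Lemma outpair_weight_ext x y w : (forall a, e w a -> x a = y a) ->
  outpair_weight x w = outpair_weight y w.
Proof.
move=> xy; apply: eq_bigr => a _; apply: eq_bigr => b _.
case wa: (e w a); last by rewrite !mul0r.
by case wb: (e w b); rewrite ?andbF ?mul0r// !xy.
Qed.

(** The quadratic form takes the value [s ^ 2 * (k u u - 2 * k u v + k v v)], and [k u v] is at most
    each diagonal entry; those entries come from the degenerate stars. *)
Lemma outpair_weight_delta (u v w : V) (s : R) :
  0 <= outpair_weight (fun a => s * ((a == u)%:R - (a == v)%:R)) w.
Proof.
have sumd (g : V -> R) :
    \sum_a g a * (s * ((a == u)%:R - (a == v)%:R)) = s * (g u - g v).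
  transitivity (\sum_a ((if a == u then s * g a else 0) -
                        (if a == v then s * g a else 0))).
    by apply: eq_bigr => a _; do 2!case: eqP => _ /=; ring.
  by rewrite sumrB -!big_mkcond !big_pred1_eq mulrBr.
pose k a b : R := [&& e w a, e w b & nonadj a b]%:R.
have -> : outpair_weight (fun a => s * ((a == u)%:R - (a == v)%:R)) w =
    s ^+ 2 * ((k u u - k u v) - (k v u - k v v)).
  transitivity (\sum_a (s * (k a u - k a v)) * (s * ((a == u)%:R - (a == v)%:R))).
    apply: eq_bigr => a _; rewrite -sumd mulr_suml; apply: eq_bigr => b _.
    by rewrite -/(k a b); ring.
  by rewrite sumd; ring.
rewrite mulr_ge0 ?sqr_ge0// /k !nonadj_refl (nonadjC v u).
case: (e w u); case: (e w v); case: (nonadj u v) => /=; lra.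
Qed.

(** For a quadratic form [Q] and [l + m = 1], the convexity gap
    [l * Q y + m * Q z - Q (l * y + m * z)] equals [l * m * Q (y - z)]. *)
Lemma outpair_weight_convex (l m : R) x y z w :
  l + m = 1 -> 0 <= l -> 0 <= m -> (forall a, x a = l * y a + m * z a) ->
  0 <= outpair_weight (fun a => y a - z a) w ->
  outpair_weight x w <= l * outpair_weight y w + m * outpair_weight z w.
Proof.
move=> lm l0 m0 hx hd; rewrite -subr_ge0.
suff -> : l * outpair_weight y w + m * outpair_weight z w - outpair_weight x w =
          l * m * outpair_weight (fun a => y a - z a) w by rewrite !mulr_ge0.
rewrite /outpair_weight !mulr_sumr -big_split -sumrB; apply: eq_bigr => a _ /=.
rewrite !mulr_sumr -big_split -sumrB; apply: eq_bigr => b _ /=.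
by rewrite !hx (_ : m = 1 - l); [ring|rewrite -lm; ring].
Qed.

Lemma star_weight_shift x u v : u != v -> nonadj u v ->
  (forall w, 0 <= x w) -> 0 < x u + x v ->
  star_weight x <= Num.max (star_weight (shift x u v)) (star_weight (shift x v u)).
Proof.
move=> uv nuv x0 s0; set y := shift x u v; set z := shift x v u.
have vu : v != u by rewrite eq_sym.
(* With these coefficients [x] is a convex combination of the two shifts. *)
set s := x u + x v in s0; pose l := x u / s; pose m := x v / s.
have s1 : s != 0 by rewrite gt_eqF.
have lm : l + m = 1 by rewrite -mulrDl divff.
have l0 : 0 <= l by rewrite divr_ge0// ltW.
have m0 : 0 <= m by rewrite divr_ge0// ltW.
have hx a : x a = l * y a + m * z a.
  rewrite /y /z /shift [x v + x u]addrC -/s.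
  case: (eqVneq a u) => [->|au]; first by rewrite (negbTE uv) mulr0 addr0 divfK.
  case: eqVneq => [->|av]; first by rewrite mulr0 add0r divfK.
  by rewrite -mulrDl lm mul1r.
have hd a : y a - z a = s * ((a == u)%:R - (a == v)%:R).
  rewrite /y /z /shift [x v + x u]addrC -/s.
  case: (eqVneq a u) => [->|au]; first by rewrite (negbTE uv) /=; ring.
  by case: eqVneq => _ /=; ring.
have conv : star_weight x <= l * star_weight y + m * star_weight z.
  rewrite /star_weight !mulr_sumr -big_split; apply: ler_sum => w _ /=.
  (* A centre [u] or [v] has neither of them as an out-neighbour, so its term is linear along the
     shift. Any other centre keeps its mass and its outpair weight is convex. *)
  have [wuv|] := boolP ((w == u) || (w == v)).
    have ew a : e w a -> (a != u) && (a != v).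
      move: nuv; rewrite /nonadj => /andP[n1 n2] wa; apply/andP; split;
      apply: contraTneq wa => ->; case/orP: wuv => /eqP->; rewrite ?e_irr//.
    rewrite (@outpair_weight_ext y x w) ?(@outpair_weight_ext z x w).
    - by rewrite [x w]hx !mulrDl !mulrA.
    - by move=> a /ew/andP[/negbTE au /negbTE av]; rewrite /z /shift au av.
    - by move=> a /ew/andP[/negbTE au /negbTE av]; rewrite /y /shift au av.
  rewrite negb_or => /andP[/negbTE wu /negbTE wv].
  have -> : y w = x w by rewrite /y /shift wu wv.
  have -> : z w = x w by rewrite /z /shift wu wv.
  rewrite mulrCA [m * _]mulrCA -mulrDr ler_wpM2l//.
  apply: outpair_weight_convex => //.
  rewrite (@outpair_weight_ext _ (fun a => s * ((a == u)%:R - (a == v)%:R))) => [|a _].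
    exact: outpair_weight_delta.
  exact: hd.
apply: le_trans conv _; set M := Num.max _ _.
rewrite -[leRHS]mul1r -lm mulrDl lerD// ler_wpM2l// /M le_max lexx ?orbT//.
Qed.

(** Induction on the size of the support: a shift in the better direction preserves the total mass
    and shrinks the support, until the support is a tournament. *)
Lemma star_weight_le (c : R) x :
  0 < c -> 3 <= c ^+ 2 + 6 * c -> (forall v, 0 <= x v) ->
  3 * star_weight x <= c * (\sum_v x v) ^+ 3.
Proof.
move=> c0 hc; have [k] := ubnP #|[set w | x w != 0]|; elim: k x => // k IH x.
rewrite ltnS => xk x0.
have [/existsP[u /existsP[v /and4P[uv nuv xu xv]]]|/existsPn H] :=
    boolP [exists u, exists v, [&& u != v, nonadj u v, x u != 0 & x v != 0]].
  have vu : v != u by rewrite eq_sym.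
  have s0 : 0 < x u + x v by rewrite addr_gt0// lt0r ?xu ?xv x0.
  have := star_weight_shift uv nuv x0 s0; rewrite le_max => /orP[] hle;
    apply: (le_trans (ler_wpM2l (ler0n _ 3) hle)).
    rewrite -(sum_shift x uv); apply: IH; last exact: shift_ge0.
    exact: leq_trans (proper_card (support_shift uv xu xv)) xk.
  rewrite -(sum_shift x vu); apply: IH; last exact: shift_ge0.
  exact: leq_trans (proper_card (support_shift vu xv xu)) xk.
rewrite star_weight_tournament => [|u v uv nuv].
  have := tournament_weight_le [set: V] c0 hc x0.
  under eq_bigl do rewrite inE.
  under eq_bigr => w _ do under eq_bigl do rewrite inE.
  by under [X in c * X ^+ 3]eq_bigl do rewrite inE.
have /existsPn/(_ v) := H u; rewrite uv nuv /= negb_and !negbK.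
by case/orP => /eqP ->; rewrite ?mul0r ?mulr0.
Qed.

End WeightedStars.

(** * Arc reversal *)

Definition reverse n (G : digraph n) : digraph n := [ffun p => G (p.2, p.1)].

Lemma reverseK n : involutive (@reverse n).
Proof. by move=> G; apply/ffunP => -[x y]; rewrite !ffunE. Qed.

Lemma is_orgraph_reverse n (G : digraph n) : is_orgraph (reverse G) = is_orgraph G.
Proof.
rewrite /is_orgraph; congr (_ && _).
  by apply: eq_forallb => x; rewrite ffunE.
by apply: eq_forallb => x; apply: eq_forallb => y; rewrite !ffunE andbC.
Qed.

Lemma induced_count_reverse k n (H : digraph k) (G : digraph n) :
  induced_count (reverse H) (reverse G) = induced_count H G.
Proof.
apply: eq_card => T; rewrite !inE; congr (_ && _).
apply: eq_existsb => f; congr [&& _, _ & _].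
apply/forallP/forallP => hf i; apply/forallP => j;
  by have /forallP/(_ i) := hf j; rewrite !ffunE.
Qed.

Lemma max_induced_reverse k (H : digraph k) n :
  max_induced (reverse H) n = max_induced H n.
Proof.
rewrite /max_induced (reindex_inj (inv_inj (@reverseK n))) /=.
by apply: eq_big => G; rewrite ?is_orgraph_reverse// induced_count_reverse.
Qed.

Lemma K21_reverse : K21 = reverse K12.
Proof. by apply/ffunP => p; rewrite !ffunE andbC. Qed.

(** * Counting induced stars *)

Section CountingStars.
Variable n : nat.
Implicit Types (G : digraph n) (T : {set 'I_n}).

Definition arc G : rel 'I_n := fun u v => G (u, v).

Lemma orgraph_asym G : is_orgraph G -> forall u v, ~~ (arc G u v && arc G v u).
Proof. by case/andP => _ /forallP h u v; have /forallP := h u; apply. Qed.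

Lemma imset_ord3 (f : {ffun 'I_3 -> 'I_n}) :
  f @: setT = [set f (inord 0); f (inord 1); f (inord 2)].
Proof.
apply/setP => y; rewrite !inE; apply/imsetP/idP => [[i _ ->]|].
  have -> : i = inord i by rewrite inord_val.
  by case: i => -[|[|[|//]]] /= _; rewrite eqxx ?orbT.
by rewrite -orbA => /or3P[] /eqP->; eexists; rewrite ?inE.
Qed.

(** Replaces embeddings of [K12] by an explicit centre [a] and leaves [b], [c], the form used in
    both counting bounds. *)
Lemma induced_K12P G T : is_orgraph G ->
  reflect (exists a b c, [/\ b != c, arc G a b, arc G a c, nonadj (arc G) b c &
                             T = [set a; b; c]])
    ((#|T| == 3) && [exists f : {ffun 'I_3 -> 'I_n},
         [&& injectiveb f, f @: setT == T &
             [forall i, forall j, G (f i, f j) == K12 (i, j)]]]).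
Proof.
move=> oG; have asym := orgraph_asym oG; apply: (iffP andP).
  move=> [_ /existsP[f /and3P[/injectiveP finj /eqP <- /forallP hf]]].
  have {}hf i j : arc G (f i) (f j) = (val i == 0%N) && (val j != 0%N).
    by have /forallP/(_ j)/eqP := hf i; rewrite ffunE.
  exists (f (inord 0)), (f (inord 1)), (f (inord 2)).
  rewrite /nonadj !hf /= !inordK//; split=> //; last exact: imset_ord3.
  by rewrite (inj_eq finj) -val_eqE /= !inordK.
move=> [a [b [c [bc ab ac /andP[nbc ncb] ->]]]].
have irr := e_irr asym.
have nab : a != b by apply: contraTneq ab => ->; rewrite irr.
have nac : a != c by apply: contraTneq ac => ->; rewrite irr.
have nba : ~~ arc G b a by have := asym a b; rewrite ab.
have nca : ~~ arc G c a by have := asym a c; rewrite ac.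
split; first by rewrite -finset.setUA cardsU1 cards2 bc !inE negb_or nab nac.
apply/existsP; exists [ffun i : 'I_3 => nth a [:: a; b; c] i]; apply/and3P; split.
- apply/injectiveP => i j; rewrite !ffunE => /eqP; rewrite nth_uniq//=.
  + by move/eqP/val_inj.
  + by rewrite !inE negb_or nab nac bc.
- by rewrite imset_ord3 !ffunE !inordK.
- apply/forallP => -[i hi]; apply/forallP => -[j hj]; rewrite !ffunE /=.
  rewrite -/(arc G _ _).
  case: i j hi hj => [|[|[|//]]] [|[|[|//]]] _ _ /=;
  by rewrite ?irr ?ab ?ac ?(negbTE nbc) ?(negbTE ncb) ?(negbTE nba) ?(negbTE nca).
Qed.

(** With unit weights each induced star appears once per ordering of its leaves, and the degenerate
    stars only add weight. *)
Lemma induced_count_K12_le (R : realFieldType) G : is_orgraph G ->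
  2 * (induced_count K12 G)%:R <= star_weight (arc G) (fun=> 1 : R).
Proof.
move=> oG; pose P w u v := [&& arc G w u, arc G w v & nonadj (arc G) u v].
pose A := [set p : 'I_n * ('I_n * 'I_n) |
            P p.1 p.2.1 p.2.2 && (p.2.1 < p.2.2)%N].
have NA : (induced_count K12 G <= #|A|)%N.
  apply: leq_trans (leq_imset_card (fun p => [set p.1; p.2.1; p.2.2]) A).
  apply: subset_leq_card; apply/fintype.subsetP => T; rewrite inE.
  move=> /(induced_K12P _ oG)[a [b [c [bc ab ac nbc ->]]]].
  have : (b < c)%N || (c < b)%N by rewrite -neq_ltn.
  case/orP => h; apply/imsetP.
    by exists (a, (b, c)); rewrite // inE /= /P ab ac nbc.
  by exists (a, (c, b)); rewrite ?inE /= /P ?ab ?ac 1?nonadjC ?nbc// finset.setUAC.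
have Asum : #|A|%:R = \sum_w \sum_u \sum_v (P w u v && (u < v)%N)%:R :> R.
  under eq_bigr => w _ do rewrite pair_bigA.
  rewrite pair_bigA /= -sum1_card natr_sum big_mkcond; apply: eq_bigr => p _.
  by rewrite inE; case: ifP.
apply: (@le_trans _ _ (2 * #|A|%:R)); first by rewrite ler_wpM2l ?ler_nat.
rewrite Asum mulr_sumr; apply: ler_sum => w _; rewrite mul1r.
(* One copy of the sum has [u] and [v] swapped: the indicators of [u < v] and [v < u] add up to at
   most 1. *)
rewrite mulr2n mulrDl mul1r {2}exchange_big /= -big_split; apply: ler_sum => u _ /=.
rewrite -big_split; apply: ler_sum => v _ /=.
rewrite !mulr1 -/(P w u v).
have -> : P w v u = P w u v by rewrite /P nonadjC andbCA.
by case: (P w u v) => /=; rewrite ?addr0// -natrD ler_nat; case: ltngtP.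
Qed.

End CountingStars.

(** The factor 6 is the 3 of [star_weight_le] times the 2 orderings of the leaves. *)
Lemma max_induced_K12_le (R : realFieldType) (c : R) n :
  0 < c -> 3 <= c ^+ 2 + 6 * c -> 6 * (max_induced K12 n)%:R <= c * n%:R ^+ 3.
Proof.
move=> c0 hc; rewrite /max_induced; elim/big_ind: _ => [|a b ha hb|G oG].
- by rewrite mulr0 mulr_ge0 ?exprn_ge0// ltW.
- by case: (leqP a b).
have := star_weight_le (orgraph_asym oG) c0 hc (fun=> ler01 : 0 <= (1 : R)).
rewrite sumr_const card_ord; apply: le_trans.
have -> : 6 = 3 * 2 :> R by ring.
by rewrite -mulrA ler_wpM2l// induced_count_K12_le.
Qed.

Lemma max_induced_le_bin k (H : digraph k) n : (max_induced H n <= 'C(n, k))%N.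
Proof.
apply/bigmax_leqP => G _; rewrite -[n in 'C(n, k)]card_ord -card_draws.
by apply/subset_leq_card/fintype.subsetP => T; rewrite !inE => /andP[].
Qed.

(** * The balanced complete bipartite orgraph *)

Definition bipartite_digraph m : digraph (m + m) :=
  [ffun p : 'I_(m + m) * 'I_(m + m) => (p.1 < m <= p.2)%N].

Lemma bipartite_orgraph m : is_orgraph (bipartite_digraph m).
Proof.
apply/andP; split; apply/forallP => x; first by rewrite ffunE /=; case: ltnP.
apply/forallP => y; rewrite !ffunE /= ![(m <= _)%N]leqNgt.
by case: (x < m)%N; case: (y < m)%N.
Qed.

(** Each left vertex forms an induced star with any two right vertices. *)
Lemma max_induced_K12_ge m : (m * 'C(m, 2) <= max_induced K12 (m + m))%N.
Proof.
pose B := @rshift m m @: [set: 'I_m].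
have cB : #|B| = m by rewrite card_imset ?cardsT ?card_ord//; exact: rshift_inj.
pose D := finset.setX [set: 'I_m] [set S : {set 'I_(m + m)} | S \subset B & #|S| == 2].
have <- : #|D| = (m * 'C(m, 2))%N by rewrite cardsX cardsT card_ord cards_draws cB.
apply: leq_trans (@leq_bigmax_cond _ _ _ _ (bipartite_orgraph m)).
pose f (p : 'I_m * {set 'I_(m + m)}) := lshift m p.1 |: p.2.
have lB a : lshift m a \notin B.
  by apply/imsetP => -[b _ /(congr1 val) /= ab]; have := ltn_ord a; rewrite ab ltnNge leq_addr.
(* Intersecting with the right side [B] recovers the leaf pair, whence the injectivity of [f] on
   [D]. *)
have fB p : p \in D -> f p :&: B = p.2.
  case: p => a S; rewrite !inE /= => /andP[SB _]; rewrite /f finset.setIUl (finset.setIidPl SB).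
  rewrite (_ : _ :&: B = finset.set0) ?finset.set0U//; apply/eqP; rewrite finset.setI_eq0.
  by rewrite disjoints1.
have finj : {in D &, injective f}.
  move=> [a S] [b S'] aD bD ff; have SS : S = S' by have := fB _ aD; rewrite ff fB.
  congr (_, _) => //; have : lshift m a \in f (b, S') by rewrite -ff finset.setU11.
  rewrite /f !inE => /orP[/eqP/lshift_inj//|].
  move: bD; rewrite !inE /= => /andP[/fintype.subsetP SB _] /SB.
  by rewrite (negbTE (lB a)).
rewrite -(card_in_imset finj); apply/subset_leq_card/fintype.subsetP => T.
move=> /imsetP[[a S] aD ->]; rewrite inE; apply/(induced_K12P _ (bipartite_orgraph m)).
move: aD; rewrite !inE /= => /andP[/fintype.subsetP SB /cards2P[b [c [bc SE]]]].
have Bm d : d \in B -> (m <= d)%N by move=> /imsetP[d' _ ->]; exact: leq_addr.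
have mb : (m <= b)%N by apply/Bm/SB; rewrite SE finset.set21.
have mc : (m <= c)%N by apply/Bm/SB; rewrite SE finset.set22.
exists (lshift m a), b, c; rewrite /nonadj /arc !ffunE /= ltn_ord mb mc.
by rewrite !ltnNge mb mc /f SE finset.setUA.
Qed.

(** * Upper limits of bounded sequences *)

Section LimSup.
Variables (R : realType) (u : nat -> R).
Hypotheses (u_ub : has_ubound (range u)) (u_lb : has_lbound (range u)).

Lemma is_cvg_sups_bounded : cvgn (sups u).
Proof. by apply/cvg_ex; exists (inf (range (sups u))); exact: cvg_sups_inf. Qed.

Lemma limn_sup_le (c : R) : (\forall n \near \oo%classic, u n <= c) -> limn_sup u <= c.
Proof.
move=> [N _ hN]; apply: limr_le; first exact: is_cvg_sups_bounded.
exists N => // n /= Nn; apply: ge_sup; first by exists (u n), n => /=.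
by move=> _ [k /= nk <-]; apply: hN; exact: leq_trans nk.
Qed.

Lemma limn_sup_ge (c : R) : (forall n, exists2 k, (n <= k)%N & c <= u k) ->
  c <= limn_sup u.
Proof.
move=> hu; apply: limr_ge; first exact: is_cvg_sups_bounded.
exists 0%N => // n _ /=; have [k nk cu] := hu n; apply: (le_trans cu).
by apply: ub_le_sup; [exact: has_ubound_sdrop|exists k].
Qed.

End LimSup.

(** * Densities and their limits *)

Lemma natr_bin3 (R : comPzRingType) n :
  6 * 'C(n, 3)%:R = n%:R * (n%:R - 1) * (n%:R - 2) :> R.
Proof.
case: n => [|[|[|n]]]; try by rewrite bin_small//=; ring.
have := bin_ffact n.+3 3; rewrite !ffactnS ffactn0 muln1 /= !factS fact0 => h.
have -> : 6 * 'C(n.+3, 3)%:R = ('C(n.+3, 3) * (3 * (2 * (1 * 1))))%N%:R :> R.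
  by rewrite mulrC natrM.
rewrite h !natrM -[n.+3]addn3 -[n.+2]addn2 -[n.+1]addn1 !natrD; ring.
Qed.

Section Density.
Variable R : realType.

Lemma density_bounds k (H : digraph k) n :
  0 <= ((max_induced H n)%:R / 'C(n, k)%:R : R) <= 1.
Proof.
rewrite divr_ge0//=; case: (posnP 'C(n, k)) => [->|c0]; first by rewrite invr0 mulr0.
by rewrite ler_pdivrMr ?ltr0n// mul1r ler_nat max_induced_le_bin.
Qed.

Lemma inducibility_le k (H : digraph k) (c : R) :
  (\forall n \near \oo%classic, (max_induced H n)%:R / 'C(n, k)%:R <= c) ->
  inducibility R H <= c.
Proof.
apply: limn_sup_le; [exists 1|exists 0] => _ [n _ <-];
  by case/andP: (density_bounds H n).
Qed.

Lemma inducibility_ge k (H : digraph k) (c : R) :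
  (forall n, exists2 m, (n <= m)%N & c <= (max_induced H m)%:R / 'C(m, k)%:R) ->
  c <= inducibility R H.
Proof.
apply: limn_sup_ge; [exists 1|exists 0] => _ [n _ <-];
  by case/andP: (density_bounds H n).
Qed.

(** On [m + m] vertices the bipartite stars have density [3 * m / (4 * (2 * m - 1))], which
    decreases to [3 / 8]. *)
Lemma inducibility_K12_ge : 3 / 8 <= inducibility R K12.
Proof.
apply: inducibility_ge => n; exists (n.+2 + n.+2)%N; first by lia.
have C0 : 0 < 'C(n.+2 + n.+2, 3)%:R :> R by rewrite ltr0n bin_gt0; lia.
rewrite ler_pdivlMr//.
apply: le_trans (_ : (n.+2 * 'C(n.+2, 2))%:R <= _); last first.
  by rewrite ler_nat max_induced_K12_ge.
have b2 : 2 * 'C(n.+2, 2)%:R = (n.+2)%:R * (n.+2%:R - 1) :> R.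
  have := bin_ffact n.+2 2; rewrite !ffactnS ffactn0 muln1 /= !factS fact0 => h.
  have -> : 2 * 'C(n.+2, 2)%:R = ('C(n.+2, 2) * (2 * (1 * 1)))%N%:R :> R.
    by rewrite mulrC natrM.
  by rewrite h natrM -[n.+2]addn2 -[n.+1]addn1 !natrD; ring.
have b3 := natr_bin3 R (n.+2 + n.+2).
rewrite natrM; move: b2 b3; rewrite natrD.
have : 2 <= n.+2%:R :> R by rewrite ler_nat.
set m := n.+2%:R : R; set x := 'C(_, 2)%:R; set y := 'C(_, 3)%:R => m2 b2 b3.
have -> : x = m * (m - 1) / 2 by rewrite -b2; field.
have -> : y = (m + m) * (m + m - 1) * (m + m - 2) / 6 by rewrite -b3; field.
rewrite -subr_ge0.
have -> : m * (m * (m - 1) / 2) -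
  3 / 8 * ((m + m) * (m + m - 1) * (m + m - 2) / 6) = m * (m - 1) / 4 by field.
by rewrite divr_ge0// mulr_ge0; lra.
Qed.

(* [max_induced_K12_le] would allow any constant above [2 * sqrt 3 - 3], which
   is 0.46410...; taking 0.4642 leaves room for [n ^ 3 / (6 * 'C(n, 3))]. *)
Lemma inducibility_K12_le : inducibility R K12 <= (46 + 44 / 100) / 100.
Proof.
apply: inducibility_le; near=> n.
(* Needed for [0.4642 * m ^ 2 <= 0.4644 * (m - 1) * (m - 2)], which holds once
   [0.0002 * m >= 3 * 0.4644], that is [m >= 6966]. *)
have n1 : (70 * 100) <= n%:R :> R by near: n; exact: nbhs_infty_ger.
have := natr_bin3 R n; have := @max_induced_K12_le R ((46 + 42 / 100) / 100) n.
move: n1; set m : R := n%:R; set x : R := (max_induced _ _)%:R.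
set y : R := 'C(_, _)%:R => n1 hx hy.
have {}hx : 6 * x <= (46 + 42 / 100) / 100 * m ^+ 3 by apply: hx; lra.
have m0 : 0 < m by lra.
have y0 : 0 < y.
  rewrite -(pmulr_rgt0 _ (_ : 0 < 6))// hy !mulr_gt0//; lra.
rewrite ler_pdivrMr// -(ler_pM2l (_ : 0 < 6))//; apply: (le_trans hx).
rewrite [leRHS]mulrCA hy -[m * _ * _]mulrA.
have -> : (46 + 42 / 100) / 100 * m ^+ 3 = m * ((46 + 42 / 100) / 100 * m ^+ 2) by ring.
rewrite [leRHS]mulrCA ler_pM2l//.
have mm : (70 * 100) * m <= m ^+ 2 by rewrite expr2 ler_pM2r.
by move: mm m0; clear; move: (m) => {}m; lra.
Unshelve. all: by end_near.
Qed.

End Density.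

Theorem theorem3 (R : realType) :
  6 - 4 * Num.sqrt 2 <= inducibility R K12 /\
  inducibility R K12 = inducibility R K21 /\
  inducibility R K21 <= 4644%:R / 10000%:R.
Proof.
have K12_K21 : inducibility R K12 = inducibility R K21.
  rewrite K21_reverse /inducibility; congr (limn_sup _).
  by apply/funext => n; rewrite max_induced_reverse.
rewrite -K12_K21; split; last first.
  split; first reflexivity.
  (* The large literals are split into small ones to reach the form of the bound in
     [inducibility_K12_le]. *)
  have -> : 10000%:R = 100%:R * 100%:R :> R.
    by rewrite -natrM; apply: (f_equal (fun k => k%:R)); vm_compute.
  have -> : 4644%:R = 46%:R * 100%:R + 44%:R :> R.
    by rewrite -natrM -natrD; apply: (f_equal (fun k => k%:R)); vm_compute.
  rewrite (_ : _ / _ = (46 + 44 / 100) / 100); last by field.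
  exact: inducibility_K12_le.
(* What remains amounts to [sqrt 2 >= 45 / 32], true since [45 ^ 2 = 2025 < 2048 = 2 * 32 ^ 2]. *)
apply: le_trans (inducibility_K12_ge R).
have := sqr_sqrtr (ler0n R 2); have := sqrtr_ge0 (2 : R).
by clear; move: (Num.sqrt 2) => s s0 s2; nra.
Qed.
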